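(* Let $X$ be a metric space and let $m\ge 0$ be an integer. Then the following conditions are equivalent: (a) $S^m$ is a large scale absolute extensor of $X$. (b) For any $s>0$ there is $t>0$ such that any finite $(m+2)$-element cover $\mathcal U=\{U_0,\ldots,U_{m+1}\}$ of $X$ with Lebesgue number greater than $t$ admits a refinement $\mathcal V$ whose Lebesgue number is greater than $s$ and whose dimension is at most $m$.
   Context: A function $f\colon X\to Y$ of metric spaces (not assumed continuous) is slowly oscillating if, for a base point $x_0\in X$ (whose choice is irrelevant), for all $R,\epsilon>0$ there is $N>0$ such that for every $x\in X$ with $d(x_0,x)>N$ the diameter of $f(B(x,R))$ is less than $\epsilon$. A metric space $K$ is a large scale absolute extensor of a metric space $X$ if for every subset $A\subset X$ and every slowly oscillating $f\colon A\to K$ there is a slowly oscillating $g\colon X\to K$ with $g|_A=f$. $S^m$ denotes the boundary $\partial\Delta^{m+1}$ of the standard unit $(m+1)$-simplex with the $\ell_1$-metric (bi-Lipschitz equivalent to the unit sphere of $\mathbb R^{m+1}$). Covers consist of arbitrary subsets. A refinement of a cover $\mathcal U$ of $X$ is a cover $\mathcal V$ of $X$ each of whose elements is contained in some element of $\mathcal U$. $\dim(\mathcal V)\le m$ means each $x\in X$ lies in at most $m+1$ elements of $\mathcal V$. The Lebesgue number of a cover $\mathcal U$ is the supremum of all $r\ge0$ such that every ball $B(x,r)$ is contained in some element of $\mathcal U$. *)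

(* Defs.v *)
From HB Require Import structures.
From mathcomp Require Import all_boot all_order all_algebra.
From mathcomp Require Import all_classical all_reals all_analysis.

Set Implicit Arguments.
Unset Strict Implicit.
Unset Printing Implicit Defensive.

Import Order.TTheory GRing.Theory Num.Theory.

Local Open Scope classical_set_scope.
Local Open Scope card_scope.
Local Open Scope ring_scope.

(* The analysis library equips [set_type A] with the pseudometric structure
   induced from X; over a metric space it is a metric. *)
Section subset_metric.
Context {R : realType} {X : metricType R} (A : set X).

Let dist (a b : A) : R := mdist (val a) (val b).

Let dist_ge0 a b : 0 <= dist a b.
Proof. exact: mdist_ge0. Qed.

Let dist_positivity a b : dist a b = 0 -> a = b.
Proof. by move=> /mdist_positivity/val_inj. Qed.

Let ballEdist (a : A) (r : R) : ball a r = [set b | dist a b < r].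
Proof.
have -> : ball a r = set_val @^-1` ball (val a : X) r by [].
by rewrite ballEmdist.
Qed.

HB.instance Definition _ := @PseudoMetric_isMetric.Build R (set_type A)
  dist dist_ge0 dist_positivity ballEdist.

Lemma subset_mdistE (a b : A) : mdist a b = mdist (val a) (val b).
Proof. by []. Qed.

End subset_metric.

Definition std_simplex (R : realType) (n : nat) : set 'rV[R]_n.+1 :=
  [set x | (forall i, 0 <= x 0 i) /\ \sum_i x 0 i = 1].

Definition std_simplex_boundary (R : realType) (n : nat) : set 'rV[R]_n.+1 :=
  [set x | std_simplex x /\ exists i, x 0 i = 0].

(* A separate type, because the subset metric that [set_type] inherits from
   ['rV[R]_m.+2] is the sup metric, not the l1 one. *)
Definition sphere (R : realType) (m : nat) : Type :=
  {x : 'rV[R]_m.+2 | x \in @std_simplex_boundary R m.+1}.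

HB.instance Definition _ (R : realType) (m : nat) := Choice.on (sphere R m).

Section sphere_metric.
Context (R : realType) (m : nat).
Implicit Types x y z : sphere R m.

Let l1_dist x y : R := \sum_i `|sval x 0 i - sval y 0 i|.

Let l1_distxx x : l1_dist x x = 0.
Proof. by rewrite /l1_dist big1// => i _; rewrite subrr normr0. Qed.

Let l1_dist_positivity x y : l1_dist x y = 0 -> x = y.
Proof.
move=> /eqP; rewrite psumr_eq0// => /allP h; apply: val_inj.
apply/rowP => i; apply/eqP; rewrite -subr_eq0 -normr_eq0.
by apply: h; rewrite mem_index_enum.
Qed.

Let l1_dist_sym x y : l1_dist x y = l1_dist y x.
Proof. by apply: eq_bigr => i _; rewrite distrC. Qed.

Let l1_dist_triangle y x z : l1_dist x z <= l1_dist x y + l1_dist y z.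
Proof. by rewrite -big_split/=; apply: ler_sum => i _; exact: ler_distD. Qed.

HB.instance Definition _ := isMetric.Build R (sphere R m)
  l1_distxx l1_dist_positivity l1_dist_sym l1_dist_triangle.

Lemma sphere_mdistE x y : mdist x y = \sum_i `|sval x 0 i - sval y 0 i|.
Proof. by []. Qed.

End sphere_metric.

Section large_scale.
Context {R : realType}.

Definition diameter {X : metricType R} (S : set X) : \bar R :=
  ereal_sup [set (mdist p.1 p.2)%:E | p in S `*` S].

Definition slowly_oscillating {X Y : metricType R} (f : X -> Y) : Prop :=
  forall (x0 : X) (r eps : R), 0 < r -> 0 < eps ->
    exists2 N : R, 0 < N &
      forall x, N < mdist x0 x -> (diameter (f @` ball x r) < eps%:E)%E.

Definition ls_absolute_extensor (K X : metricType R) : Prop :=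
  forall (A : set X) (f : A -> K), slowly_oscillating f ->
    exists2 g : X -> K, slowly_oscillating g & forall a : A, g (val a) = f a.

End large_scale.

Definition is_cover {T : Type} (C : set (set T)) : Prop := cover C id = setT.

Definition is_refinement {T : Type} (U V : set (set T)) : Prop :=
  is_cover V /\ forall B, V B -> exists2 A, U A & B `<=` A.

Definition cover_dim_le {T : Type} (V : set (set T)) (m : nat) : Prop :=
  forall x : T, [set B | V B /\ B x] #<= `I_m.+1.

Definition lebesgue_number {R : realType} {X : metricType R}
    (C : set (set X)) : \bar R :=
  ereal_sup [set r%:E | r in
    [set r : R | 0 <= r /\ forall x, exists2 A, C A & ball x r `<=` A]].

(* Main.v *)
(* Write n = m + 2. Both conditions are equivalent to the following one: for
   every s, each cover U_0, ..., U_(n-1) of large Lebesgue number admits a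
   coloring c of the points of X by n colors such that the s-ball about x lies
   in U_(c x) and no s-ball carries all n colors. Refinements of dimension at
   most m and such colorings are easily traded for one another.

   A compactness argument shows that a cover without a coloring already fails
   to have one on a bounded part of X, which may be taken far from the base
   point. If thicker and thicker such covers exist, their canonical maps into
   the simplex over far apart bounded pieces, restricted to the preimage of
   the boundary, form a slowly oscillating map; coloring x by the largest
   coordinate of an extension gives a contradiction.

   Conversely, colorings allow one to extend a map into the boundary of the
   simplex with uniform control at a single scale. Choosing slabs (annuli about
   the base point) with growing gaps, such extensions of increasing quality
   are patched together, first on the even slabs, then on the odd ones. *)
Require Import Defs.
From HB Require Import structures.
From mathcomp Require Import all_boot all_order all_algebra.
From mathcomp Require Import all_classical all_reals all_analysis.
From mathcomp Require Import ring lra zify.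

Set Implicit Arguments.
Unset Strict Implicit.
Unset Printing Implicit Defensive.

Import Order.TTheory GRing.Theory Num.Theory.

Local Open Scope classical_set_scope.
Local Open Scope ring_scope.

(** * McShane extensions and bump functions *)

(* The cap at [1] keeps the infimum meaningful when [P] is empty. *)
Definition mcshane (R : realType) (X : metricType R) (P : set X) (h : X -> R)
    (L : R) (x : X) : R :=
  inf [set r | r = 1 \/ exists2 a, P a & r = h a + L * mdist x a].

Section mcshane_theory.
Context {R : realType} {X : metricType R}.
Context (P : set X) (h : X -> R) (L : R).
Context (h_ge0 : forall a, P a -> 0 <= h a) (L_ge0 : 0 <= L).

Lemma mcshane_has_lbound x : has_lbound
  [set r | r = 1 \/ exists2 a, P a & r = h a + L * mdist x a].
Proof.
exists 0 => r [->//|[a Pa ->]].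
by rewrite addr_ge0 ?h_ge0// mulr_ge0// mdist_ge0.
Qed.

Lemma mcshane_lower v x : v <= 1 ->
  (forall a, P a -> v <= h a + L * mdist x a) -> v <= mcshane P h L x.
Proof.
move=> v1 vP; apply: lb_le_inf; first by exists 1; left.
by move=> r [->//|[a Pa ->]]; exact: vP.
Qed.

Lemma mcshane_ge0 x : 0 <= mcshane P h L x.
Proof.
apply: mcshane_lower => // a Pa.
by rewrite addr_ge0 ?h_ge0// mulr_ge0// mdist_ge0.
Qed.

Lemma mcshane_le1 x : mcshane P h L x <= 1.
Proof. by apply: ge_inf; [exact: mcshane_has_lbound|left]. Qed.

Lemma mcshane_upper x a : P a -> mcshane P h L x <= h a + L * mdist x a.
Proof.
by move=> Pa; apply: ge_inf; [exact: mcshane_has_lbound|right; exists a].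
Qed.

Lemma mcshane_ltP x v : v <= 1 -> mcshane P h L x < v ->
  exists2 a, P a & h a + L * mdist x a < v.
Proof.
move=> v1; rewrite /mcshane; set E := (X in inf X) => ltv.
have E0 : has_inf E by split; [exists 1; left|exact: mcshane_has_lbound].
have [|r Er] := @inf_adherent R E (v - inf E) _ E0; first by rewrite subr_gt0.
rewrite subrKC; case: Er => [->|[a Pa ->]].
  by rewrite ltNge v1.
by exists a.
Qed.

Lemma mcshane_lip x y :
  mcshane P h L x <= mcshane P h L y + L * mdist x y.
Proof.
rewrite -lerBlDr; apply: mcshane_lower => [|a Pa].
  rewrite lerBlDr; apply: le_trans (mcshane_le1 x) _.
  by rewrite lerDl mulr_ge0// mdist_ge0.
rewrite lerBlDr -addrA -mulrDr; apply: le_trans (mcshane_upper x Pa) _.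
by rewrite lerD2l ler_wpM2l// addrC metric_triangle.
Qed.

End mcshane_theory.

(** This is [max(0, 1 - d(x, P) / s)], read as 0 when [P] is empty. *)
Definition proximity (R : realType) (X : metricType R) (P : set X) (s : R)
    (x : X) : R := 1 - mcshane P (fun=> 0) s^-1 x.

Section proximity_theory.
Context {R : realType} {X : metricType R}.
Context (P : set X) (s : R) (s_gt0 : 0 < s).

Let sV_ge0 : 0 <= s^-1. Proof. by rewrite invr_ge0 ltW. Qed.

Lemma proximity_ge0 x : 0 <= proximity P s x.
Proof. by rewrite subr_ge0 mcshane_le1. Qed.

Lemma proximity_le1 x : proximity P s x <= 1.
Proof. by rewrite gerBl mcshane_ge0. Qed.

Lemma proximity1 x : P x -> proximity P s x = 1.
Proof.
move=> Px; have h0 a : P a -> (0 : R) <= 0 by [].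
have := mcshane_upper h0 sV_ge0 x Px; have := mcshane_ge0 h0 sV_ge0 x.
by rewrite mdistxx mulr0 addr0 /proximity; lra.
Qed.

Lemma proximity_gt0P x : 0 < proximity P s x -> exists2 a, P a & mdist x a < s.
Proof.
rewrite subr_gt0 => /mcshane_ltP[] // a Pa.
by rewrite add0r mulrC ltr_pdivrMr// mul1r; exists a.
Qed.

Lemma proximity_eq0 x : (forall a, P a -> s <= mdist x a) -> proximity P s x = 0.
Proof.
move=> sx; apply/eqP; rewrite eq_le proximity_ge0 andbT leNgt.
by apply/negP => /proximity_gt0P[a Pa]; rewrite ltNge sx.
Qed.

Lemma proximity_lip x y : proximity P s x <= proximity P s y + s^-1 * mdist x y.
Proof.
have h0 a : P a -> (0 : R) <= 0 by [].
have := mcshane_lip h0 sV_ge0 y x.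
by rewrite (metric_sym y) /proximity; lra.
Qed.

Lemma proximity_dist x y :
  `|proximity P s x - proximity P s y| <= s^-1 * mdist x y.
Proof.
have := proximity_lip x y; have := proximity_lip y x.
by rewrite (metric_sym y) ler_norml => ? ?; apply/andP; split; lra.
Qed.

End proximity_theory.

(** * Coordinates and weights on the boundary of the simplex *)

Section sphere_theory.
Context {R : realType} {m : nat}.
Implicit Types p q : sphere R m.

Lemma sphere_ge0 p i : 0 <= sval p 0 i.
Proof. by case: p => x /= /set_mem[[]]. Qed.

Lemma sphere_sum p : \sum_i sval p 0 i = 1.
Proof. by case: p => x /= /set_mem[[]]. Qed.

Lemma sphere_zero p : exists i, sval p 0 i = 0.
Proof. by case: p => x /= /set_mem[]. Qed.

Lemma sphere_le1 p i : sval p 0 i <= 1.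
Proof.
rewrite -(sphere_sum p) (bigD1 i)//= lerDl sumr_ge0// => j _.
exact: sphere_ge0.
Qed.

Lemma sphere_coord_le p q i : `|sval p 0 i - sval q 0 i| <= mdist p q.
Proof. by rewrite sphere_mdistE (bigD1 i)//= lerDl sumr_ge0. Qed.

Lemma sphere_coord_large p : exists i, m.+2%:R^-1 <= sval p 0 i.
Proof.
apply/not_existsP => small; have := ltxx (1 : R).
rewrite -{1}(sphere_sum p) => /negP; apply.
have -> : 1 = \sum_(i < m.+2) m.+2%:R^-1 :> R.
  by rewrite sumr_const card_ord -[RHS]mulr_natr mulVf// pnatr_eq0.
apply: ltr_sum => [|i _]; last by rewrite ltNge; apply/negP.
by apply/hasP; exists ord0; rewrite ?mem_index_enum.
Qed.

Lemma sphere_of_weights (w : 'I_m.+2 -> R) : (forall i, 0 <= w i) ->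
  0 < \sum_i w i -> (exists i, w i = 0) ->
  exists p, forall i, sval p 0 i = w i / \sum_j w j.
Proof.
move=> w0 W0 [k wk].
have wP : (\row_i (w i / \sum_j w j)) \in @std_simplex_boundary R m.+1.
  apply/mem_set; split; last by exists k; rewrite mxE wk mul0r.
  split=> [i|]; first by rewrite mxE divr_ge0// ltW.
  under eq_bigr do rewrite mxE.
  by rewrite -mulr_suml divff// gt_eqF.
by exists (exist (fun x => x \in @std_simplex_boundary R m.+1) _ wP) => i /=; rewrite mxE.
Qed.

(** With sums [W] and [V], write [w/W - v/V = (w - v)/W + ((V - W)/W) (v/V)]. Summed over the
    coordinates, each of the two terms contributes at most [(m + 2) e / W], whence the factor 2. *)
Lemma sphere_mdist_weights p q (w v : 'I_m.+2 -> R) (e b : R) :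
  (forall i, sval p 0 i = w i / \sum_j w j) ->
  (forall i, sval q 0 i = v i / \sum_j v j) ->
  (forall i, 0 <= v i) -> 0 < \sum_j v j ->
  0 < b -> b <= \sum_j w j -> (forall i, `|w i - v i| <= e) ->
  mdist p q <= 2 * m.+2%:R * e / b.
Proof.
set W := \sum_j w j; set V := \sum_j v j => pw qv v0 V0 b0 bW wve.
have W0 : 0 < W by exact: lt_le_trans bW.
have wvS : \sum_i `|w i - v i| <= m.+2%:R * e.
  apply: le_trans (ler_sum _ (fun i _ => wve i)) _.
  by rewrite sumr_const card_ord mulr_natl.
have WVS : `|W - V| <= m.+2%:R * e.
  by rewrite -sumrB; apply: le_trans (ler_norm_sum _ _ _) wvS.
suff : mdist p q <= (\sum_i `|w i - v i|) / W + `|W - V| / W.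
  move/le_trans; apply; rewrite -mulrDl ler_pM//.
  - by rewrite addr_ge0// sumr_ge0.
  - by rewrite invr_ge0 ltW.
  - by rewrite -mulrA; lra.
  - by rewrite lef_pV2.
rewrite sphere_mdistE.
have -> : `|W - V| / W = \sum_i `|W - V| / W * (v i / V).
  by rewrite -mulr_sumr -mulr_suml divff ?mulr1// gt_eqF.
rewrite mulr_suml -big_split/=; apply: ler_sum => i _; rewrite pw qv.
have -> : w i / W - v i / V = (w i - v i) / W + (V - W) / W * (v i / V).
  rewrite -/W -/V; have := lt0r_neq0 W0; have := lt0r_neq0 V0 => ? ?.
  by field; apply/andP.
apply: le_trans (ler_normD _ _) _; rewrite !normrM normfV (gtr0_norm W0).
by rewrite (distrC V) (ger0_norm (v0 i)) normfV (gtr0_norm V0).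
Qed.

End sphere_theory.

(** * Slow oscillation in terms of pairs of points *)

Section slow_oscillation.
Context {R : realType}.

Lemma diameter_ge (K : metricType R) (S : set K) p q :
  S p -> S q -> ((mdist p q)%:E <= diameter S)%E.
Proof. by move=> Sp Sq; apply: ereal_sup_ubound; exists (p, q). Qed.

(** The base point sits in the ambient [X] and may lie outside the image of [h], which below is a
    subset inclusion or the identity. A change of base point adds the distance between the two to
    [N]. *)
Lemma slowly_oscillatingP (X Y K : metricType R) (h : Y -> X) (f : Y -> K)
    (x0 : X) : (forall a b, mdist a b = mdist (h a) (h b)) ->
  slowly_oscillating f <->
  forall r eps : R, 0 < r -> 0 < eps -> exists N : R, forall a b,
    N < mdist x0 (h a) -> mdist a b < r -> mdist (f a) (f b) < eps.
Proof.
move=> hE; split=> [fso r eps r0 eps0|fso y0 r eps r0 eps0].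
  have [[y0 _]|noY] := pselect (exists y : Y, True); last first.
    by exists 0 => a; exfalso; apply: noY; exists a.
  have [N N0 NP] := fso y0 r eps r0 eps0.
  exists (N + mdist x0 (h y0)) => a b Na ab.
  have /NP dlt : N < mdist y0 a.
    by have := metric_triangle x0 (h y0) (h a); rewrite hE; lra.
  rewrite -lte_fin; apply: le_lt_trans dlt; apply: diameter_ge.
    by exists a => //; rewrite ballEmdist/= mdistxx.
  by exists b => //; rewrite ballEmdist.
(* Two points of a ball are each compared with its centre, so the diameter is at most [2 eps / 3],
   strictly below [eps]. *)
have [|N NP] := fso r (eps / 3) r0; first by lra.
exists (Num.max 1 (N + mdist x0 (h y0))); first by rewrite lt_max ltr01.
move=> x; rewrite gt_max => /andP[_ Nx].
apply: (@le_lt_trans _ _ (2 * (eps / 3))%:E); last by rewrite lte_fin; lra.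
have xN : N < mdist x0 (h x).
  have := metric_triangle (h y0) x0 (h x).
  by rewrite (metric_sym (h y0) x0) -hE; lra.
apply: ge_ereal_sup => _ [[p q] /= [[a + <-] [b + <-]] <-].
rewrite !ballEmdist/= => /(NP _ _ xN) fa /(NP _ _ xN) fb.
rewrite lee_fin; apply: le_trans (metric_triangle _ (f x) _) _.
by rewrite (metric_sym (f a)); lra.
Qed.

End slow_oscillation.

(** * Uniform extension at one scale, and patching over slabs *)

Definition oscillates (R : realType) (X K : metricType R) (A : set X)
    (f : X -> K) (r eps : R) : Prop :=
  forall x y, A x -> A y -> mdist x y < r -> mdist (f x) (f y) < eps.

Definition slow_on (R : realType) (X K : metricType R) (x0 : X) (A : set X)
    (f : X -> K) : Prop :=
  forall r eps : R, 0 < r -> 0 < eps ->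
    exists N : R, oscillates (A `&` [set x | N < mdist x0 x]) f r eps.

(** As [t] and [delta] depend on [r] and [eps] alone, they can be fixed first, and a slowly
    oscillating map then restricted to a tail far enough out to satisfy them. *)
Definition uniform_extensor (R : realType) (K X : metricType R) : Prop :=
  forall r eps : R, 0 < r -> 0 < eps -> exists t delta : R,
    [/\ 0 < t, 0 < delta & forall (A : set X) (f : X -> K),
      oscillates A f t delta ->
      exists2 g : X -> K, oscillates setT g r eps & forall a, A a -> g a = f a].

Definition slab (R : realType) (X : metricType R) (x0 : X) (a b : nat) : set X :=
  [set x | a%:R <= mdist x0 x < b%:R].

Lemma natr_bound (R : realType) (x : R) : exists n : nat, x < n%:R.
Proof. by exists (Num.truncn x).+1; exact: truncnS_gt. Qed.

(** Take the largest admissible rank, which exists because ranks are bounded by [j]; the value is 0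
    if no rank is admissible. *)
Lemma maximal_rank (N a : nat -> nat) : exists k : nat -> nat, forall j K,
  (K <= j)%N -> (N K + K <= a j)%N -> (K <= k j)%N /\ (N (k j) + k j <= a j)%N.
Proof.
suff /choice[k kP] : forall j, exists k, forall K,
    (K <= j)%N -> (N K + K <= a j)%N -> (K <= k)%N /\ (N k + k <= a j)%N.
  by exists k.
move=> j; pose P k := (k <= j)%N && (N k + k <= a j)%N.
have [exP|noP] := pselect (exists k, P k); last first.
  by exists 0 => K Kj KN; exfalso; apply: noP; exists K; apply/andP.
have Pub k : P k -> (k <= j)%N by case/andP.
exists (ex_maxn exP Pub) => K Kj KN; case: ex_maxnP => k /andP[_ Pk] kmax.
by split=> //; apply: kmax; apply/andP.
Qed.

(* On the [j]-th slab one uses a uniform extension whose quality improves with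
   [j]; as the gaps between slabs grow, a ball of fixed radius far away from
   [x0] meets at most one slab. *)
Lemma slow_extension_to_slabs (R : realType) (K X : metricType R) (x0 : X)
    (A : set X) (f : X -> K) (a b : nat -> nat) :
  uniform_extensor K X -> slow_on x0 A f ->
  (forall j l, (j < l)%N -> (b j + j <= a l)%N) -> (forall j, (j <= a j)%N) ->
  exists2 f1 : X -> K, slow_on x0 (A `|` \bigcup_j slab x0 (a j) (b j)) f1 &
    forall x, A x -> f1 x = f x.
Proof.
move=> ue fso bja ja.
(* [G k] pairs a threshold with a map that has oscillation below [1 / (k + 1)] at scale [k + 1] and
   agrees with [f] on the part of [A] beyond the threshold. *)
have /choice[G GP] : forall k : nat, exists p : nat * (X -> K),
    oscillates setT p.2 k.+1%:R k.+1%:R^-1 /\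
    forall x, A x -> p.1%:R < mdist x0 x -> p.2 x = f x.
  move=> k; have k0 : 0 < k.+1%:R :> R by rewrite ltr0n.
  have kV0 : 0 < k.+1%:R^-1 :> R by rewrite invr_gt0.
  have [t [delta [t0 delta0 ext]]] := ue _ _ k0 kV0.
  have [N NP] := fso _ _ t0 delta0.
  have [g gosc gf] := ext _ _ NP.
  have [n Nn] := natr_bound N.
  exists (n, g); split=> // x Ax nx; apply: gf; split=> //=.
  exact: lt_trans nx.
have [k kP] := maximal_rank (fun k => (G k).1) a.
have /choice[jx jxP] : forall x, exists j,
    (\bigcup_j slab x0 (a j) (b j)) x -> slab x0 (a j) (b j) x.
  move=> x; have [[j _ jx]|nox] := pselect ((\bigcup_j slab x0 (a j) (b j)) x).
    by exists j.
  by exists 0 => /nox.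
exists (fun x => if `[< A x >] then f x else (G (k (jx x))).2 x); last first.
  by move=> x Ax; case: asboolP.
move=> r eps r0 eps0; have [N1 N1P] := fso _ _ r0 eps0.
have [n1 rn1] := natr_bound r; have [n2 en2] := natr_bound eps^-1.
(* Rank [Q] is good enough for [r] and [eps]. From slab [J] on, the rank in use is at least [Q],
   because [j <= a j]. *)
pose Q := maxn n1 n2; pose J := maxn Q ((G Q).1 + Q).
have rQ : r < Q%:R by apply: lt_le_trans rn1 _; rewrite ler_nat leq_maxl.
have eQ : forall q, (Q <= q)%N -> q.+1%:R^-1 <= eps.
  move=> q Qq; rewrite invf_ple ?posrE//; apply/ltW.
  apply: lt_le_trans en2 _.
  by rewrite ler_nat leqW// (leq_trans _ Qq)// leq_maxr.
have kJ j : (J <= j)%N -> (Q <= k j)%N /\ ((G (k j)).1 + k j <= a j)%N.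
  rewrite geq_max => /andP[Qj Nj]; apply: kP => //.
  exact: leq_trans Nj (ja j).
exists (Num.max N1 (a J)%:R).
have jxJ x : (\bigcup_j slab x0 (a j) (b j)) x -> (a J)%:R < mdist x0 x ->
    (J <= jx x)%N.
  move=> /jxP/andP[_ xb] ax; rewrite leqNgt; apply/negP => /bja.
  move=> /(leq_trans (leq_addr _ _)); rewrite -(ler_nat R) => ?.
  by have := lt_trans ax xb; rewrite ltNge => /negP.
(* Near a point [x] of a far slab all values come from the one map chosen for that slab: on [A]
   because that map agrees with [f] there, on the slabs because the gaps exceed [r]. *)
have one x y : (\bigcup_j slab x0 (a j) (b j)) x -> (a J)%:R < mdist x0 x ->
    (a J)%:R < mdist x0 y -> A y \/ (\bigcup_j slab x0 (a j) (b j)) y ->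
    mdist x y < r ->
    mdist ((G (k (jx x))).2 x)
      (if `[< A y >] then f y else (G (k (jx y))).2 y) < eps.
  move=> Sx Nx Ny Ay xy; have Jx := jxJ _ Sx Nx.
  have [Qk ka] := kJ _ Jx.
  have /andP[xa xb] := jxP _ Sx.
  have triy := metric_triangle x0 y x; have trix := metric_triangle x0 x y.
  have -> : (if `[< A y >] then f y else (G (k (jx y))).2 y) =
      (G (k (jx x))).2 y.
    case: asboolP => [{}Ay|nAy].
      rewrite (GP _).2//; rewrite (metric_sym y x) in triy.
      have : (((G (k (jx x))).1 + Q)%:R : R) <= (a (jx x))%:R.
        by rewrite ler_nat (leq_trans _ ka)// leq_add2l.
      by rewrite natrD; lra.
    case: Ay => // Sy; have Jy := jxJ _ Sy Ny.
    have /andP[ya yb] := jxP _ Sy.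
    have gap j l : (J <= j)%N -> (j < l)%N -> (b j)%:R + r < (a l)%:R :> R.
      move=> Jj /bja jl; apply: (@lt_le_trans _ _ ((b j)%:R + Q%:R)).
        by rewrite ltrD2l.
      rewrite -natrD ler_nat (leq_trans _ jl)// leq_add2l.
      by apply: leq_trans Jj; rewrite leq_maxl.
    case: (ltngtP (jx x) (jx y)) => [lt|lt|->//].
      by exfalso; have := gap _ _ Jx lt; lra.
    exfalso; rewrite (metric_sym y x) in triy.
    by have := gap _ _ Jy lt; lra.
  apply: lt_le_trans ((GP _).1 x y _ _ _) (eQ _ Qk) => //.
  apply: lt_trans xy _; apply: lt_le_trans rQ _.
  by rewrite ler_nat leqW.
move=> x y [Ax /=]; rewrite gt_max => /andP[Nx ax].
move=> [Ay /=]; rewrite gt_max => /andP[Ny ay] xy.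
case: (asboolP (A x)) => Ax'; last by apply: one => //; case: Ax.
case: (asboolP (A y)) => Ay'; first exact: N1P.
rewrite metric_sym; have := one y x; case: (asboolP (A x)) => // _; apply => //.
- by case: Ay.
- by rewrite metric_sym.
Qed.

Lemma between_squares (R : realType) (x : R) : 0 <= x ->
  exists n : nat, (n ^ 2)%:R <= x < (n.+1 ^ 2)%:R.
Proof.
move=> x0; have [N xN] := natr_bound x.
have exn : exists n : nat, x < (n.+1 ^ 2)%:R.
  exists N; apply: lt_le_trans xN _; rewrite ler_nat.
  by rewrite (leq_trans (leqnSn N))// leq_pmull.
exists (ex_minn exn); case: ex_minnP => n xn nmin; rewrite xn andbT.
case: n xn nmin => [//|n] xn nmin; rewrite leNgt; apply/negP => /nmin.
by rewrite ltnn.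
Qed.

(** Slabs between consecutive squares cover [X], and those of equal parity are separated by linearly
    growing gaps. The second pass extends from [A] together with the even slabs. *)
Lemma uniform_extensor_ls (R : realType) (K X : metricType R) (p0 : K) (x0 : X) :
  uniform_extensor K X -> ls_absolute_extensor K X.
Proof.
move=> ue A f fso.
have /choice[f' f'E] : forall x, exists p, forall a : A, val a = x -> f a = p.
  move=> x; have [[a ax]|noa] := pselect (exists a : A, val a = x).
    by exists (f a) => b; rewrite -ax => /val_inj ->.
  by exists p0 => a ax; exfalso; apply: noa; exists a.
have f'so : slow_on x0 A f'.
  move=> r eps r0 eps0.
  have [N NP] :=
    (slowly_oscillatingP f x0 (fun a b => subset_mdistE a b)).1 fso r eps r0 eps0.
  exists N => x y [/mem_set Ax Nx] [/mem_set Ay Ny] xy.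
  rewrite -(f'E x (SigSub Ax))// -(f'E y (SigSub Ay))//.
  exact: NP.
have [|j|f1 f1so f1E] := @slow_extension_to_slabs _ K X x0 A f'
  (fun j => (2 * j) ^ 2)%N (fun j => (2 * j).+1 ^ 2)%N ue f'so.
- by move=> j l jl; nia.
- by nia.
have [|j|f2 f2so f2E] := slow_extension_to_slabs
  (a := fun j => ((2 * j).+1 ^ 2)%N) (b := fun j => ((2 * j).+2 ^ 2)%N) ue f1so.
- by move=> j l jl; nia.
- by nia.
exists f2 => [|a]; last first.
  have Aa : A (val a) by exact: set_valP.
  by rewrite f2E ?f1E -?(f'E _ a)//; left.
apply/(slowly_oscillatingP (h := id) f2 x0) => // r eps r0 eps0.
have [N NP] := f2so r eps r0 eps0.
have all x : (A `|` \bigcup_j slab x0 ((2 * j) ^ 2) ((2 * j).+1 ^ 2) `|`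
    \bigcup_j slab x0 ((2 * j).+1 ^ 2) ((2 * j).+2 ^ 2)) x.
  have [n nx] := between_squares (mdist_ge0 x0 x).
  have [q [nq|nq]] : exists q, n = (2 * q)%N \/ n = (2 * q).+1.
    by exists n./2; lia.
  by left; right; exists q => //; rewrite -nq.
  by right; exists q => //; rewrite -nq.
exists (N + r) => x y Nx xy; apply: NP => //.
  by split; [exact: all|rewrite /= in Nx *; lra].
split; first exact: all.
have := metric_triangle x0 y x; rewrite (metric_sym y x) /= in Nx *; lra.
Qed.

(** * Thick covers and colorings *)

(** A Lebesgue number condition freed from the supremum; the two agree up to an arbitrarily small
    loss in [t]. *)
Definition thick (R : realType) (X : metricType R) (n : nat)
    (U : 'I_n -> set X) (t : R) : Prop :=
  forall x, exists i, forall y, mdist x y < t -> U i y.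

(* The sets [{y | mdist x y < s for some x with c x = i}] then form a
   refinement of [U] of multiplicity less than [n]. *)
Definition coloring (R : realType) (X : metricType R) (n : nat) (E : set X)
    (U : 'I_n -> set X) (s : R) (c : X -> 'I_n) : Prop :=
  (forall x y, E x -> E y -> mdist x y < s -> U (c x) y) /\
  (forall y, E y -> exists i, forall x, E x -> mdist x y < s -> c x <> i).

Section colorings.
Local Open Scope card_scope.
Context {R : realType} {X : metricType R}.

Lemma thick_lebesgue (n : nat) (U : 'I_n -> set X) (t : R) :
  (t%:E < lebesgue_number (range U))%E -> thick U t.
Proof.
move=> /ereal_sup_gt[_ [r [_ rU] <-]]; rewrite lte_fin => tr x.
have [_ [i _ <-] xU] := rU x; exists i => y xy; apply: xU.
by rewrite ballEmdist/=; exact: lt_trans tr.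
Qed.

Lemma lebesgue_thick (n : nat) (U : 'I_n -> set X) (s t : R) :
  0 <= s -> s < t -> thick U t -> (s%:E < lebesgue_number (range U))%E.
Proof.
move=> s0 st Ut; apply: (@lt_le_trans _ _ t%:E); first by rewrite lte_fin.
apply: ereal_sup_ubound; exists t => //; split.
  exact: le_trans (ltW st).
move=> x; have [i xU] := Ut x; exists (U i); first by exists i.
by move=> y; rewrite ballEmdist/=; exact: xU.
Qed.

(** Each [x] picks an element [B x] of [V] around its ball, and its color is the index of a member
    of [U] containing [B x]. If all m+2 colors occurred near [y], then [y] would lie in m+2 distinct
    sets [B x], one per color. *)
Lemma refinement_coloring (m : nat) (U : 'I_m.+2 -> set X) (V : set (set X))
    (s : R) : is_refinement (range U) V -> (s%:E < lebesgue_number V)%E ->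
  cover_dim_le V m -> exists c, coloring setT U s c.
Proof.
move=> [_ VU] /ereal_sup_gt[_ [r [_ rV] <-]]; rewrite lte_fin => sr dimV.
have /choice[B BP] : forall x, exists B, V B /\ ball x r `<=` B.
  by move=> x; have [A] := rV x; exists A.
have /choice[h hP] : forall C, exists i, V C -> C `<=` U i.
  move=> C; have [VC|nVC] := pselect (V C); last by exists ord0.
  by have [_ [i _ <-] CU] := VU _ VC; exists i.
have xB x y : mdist x y < s -> B x y.
  by move=> xy; apply: (BP x).2; rewrite ballEmdist/=; exact: lt_trans sr.
exists (h \o B); split=> [x y _ _ /xB|y _]; first by apply: hP (BP x).1 _.
apply/not_existsP => /= all_colors.
have : `I_m.+2 #<= `I_m.+1; last by rewrite card_le_II ltnn.
apply: card_le_trans (dimV y).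
apply: card_le_trans (card_image_le h _).
apply: (@card_le_trans _ _ _ [set: 'I_m.+2]).
  by have /card_eqPle[] := @card_II m.+2.
apply: subset_card_le => i _; have := all_colors i.
move=> /existsNP[x /not_implyP[_ /not_implyP[xy /contrapT cx]]].
by exists (B x) => //; split; [exact: (BP x).1|exact: xB].
Qed.

Lemma coloring_refinement (m : nat) (U : 'I_m.+2 -> set X) (s t : R) c :
  0 < s -> s < t -> coloring setT U t c ->
  exists V, [/\ is_refinement (range U) V, (s%:E < lebesgue_number V)%E &
    cover_dim_le V m].
Proof.
move=> s0 st [cU cmiss].
pose V i := [set y | exists2 x, c x = i & mdist x y < t].
have Vt : thick V t by move=> x; exists (c x) => y xy; exists x.
exists (range V); split; first split.
- apply/seteqP; split=> // x _; exists (V (c x)); first by exists (c x).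
  by exists x => //; rewrite mdistxx; lra.
- move=> _ [i _ <-]; exists (U i); first by exists i.
  by move=> y [x <- xy]; exact: cU.
- by apply: lebesgue_thick st Vt; exact: ltW.
- move=> y; have [i0 i0P] := cmiss y I.
  (* [lift i0] enumerates the m+1 indices other than the color missed near [y]. *)
  apply: (@card_le_trans _ _ _ [set: 'I_m.+1]); last first.
    by have /card_eqPle[] := @card_II m.+1.
  apply: card_le_trans (card_image_le (fun j => V (lift i0 j)) _).
  apply: subset_card_le => _ [[i _ <-] Viy].
  case: (unliftP i0 i) Viy => [j ->|->] Viy; first by exists j.
  by case: Viy => x cx xy; exfalso; exact: i0P cx.
Qed.

(** The color of [x] is the limit of its colors along a nonprincipal ultrafilter. A violation of
    either condition involves finitely many points, so a single [c j] would already exhibit it. *)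
Lemma coloring_compact (x0 : X) (n : nat) (E : set X) (U : 'I_n -> set X)
    (s : R) :
  (forall j : nat, exists c, coloring (E `&` [set x | mdist x0 x < j%:R]) U s c) ->
  exists c, coloring E U s c.
Proof.
move=> /choice[c cP].
have [G [Gultra Goo]] := ultraFilterLemma eventually_filter.
have Gproper := @ultra_proper _ _ Gultra.
have GI A B : G A -> G B -> G (A `&` B) by exact: filterI.
have /choice[d dP] : forall x, exists i, G [set j | c j x = i].
  move=> x; apply/not_existsP => nox.
  have /filter_ex[j] : G [set j | forall i, c j x <> i].
    apply: filter_forall => i.
    by have [/nox|] := in_ultra_setVsetC [set j | c j x = i] Gultra.
  by move=> /(_ (c j x)); apply.
have Gball x : G [set j | mdist x0 x < j%:R].
  apply: Goo; have [k xk] := natr_bound (mdist x0 x).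
  by exists k => // j /= kj; apply: lt_le_trans xk _; rewrite ler_nat.
exists d; split=> [x y Ex Ey xy|y Ey].
  have /filter_ex[j [<- [xj yj]]] := GI _ _ (dP x) (GI _ _ (Gball x) (Gball y)).
  by apply: (cP j).1.
apply/not_existsP => all_colors.
have /choice[x xP] : forall i, exists x, [/\ E x, mdist x y < s & d x = i].
  move=> i; have /existsNP[x] := all_colors i.
  by move=> /not_implyP[Ex /not_implyP[xy /contrapT dx]]; exists x.
have : G [set j | forall i, mdist x0 (x i) < j%:R /\ c j (x i) = i].
  apply: filter_forall => i; have [_ _ dxi] := xP i.
  by apply: GI; [exact: Gball|rewrite -{2}dxi; exact: dP].
move=> /(GI _ _ (Gball y))/filter_ex[j [/= yj xj]].
have [|i iP] := (cP j).2 y; first by [].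
have [Exi xiy _] := xP i; have [xij cxi] := xj i.
exact: iP cxi.
Qed.

(* Shrinking all but one set of the cover away near [x0] makes every coloring
   constant there, so that it extends to the whole space. *)
Lemma uncolorable_slab (x0 : X) (m : nat) (s : R) : 0 < s ->
  (forall t : R, 0 < t -> exists2 U : 'I_m.+2 -> set X,
     thick U t & ~ exists c, coloring setT U s c) ->
  forall N k : nat, exists (U : 'I_m.+2 -> set X) (M : nat),
    thick U k.+1%:R /\ ~ exists c, coloring (slab x0 N M) U s c.
Proof.
(* Since [t / 4 >= k + 1], the shrunken cover keeps thickness [k + 1]; since [t / 2 >= N + 4 s],
   there is a collar beyond [N] where only color [i0] is available. *)
move=> s0 bad N k; pose t : R := 4 * k.+1%:R + 2 * (N%:R + 4 * s).
have k0 : 0 < k.+1%:R :> R by rewrite ltr0n.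
have N0 : 0 <= N%:R :> R by rewrite ler0n.
have [|U Ut Ubad] := bad t; first by rewrite /t; lra.
have [i0 i0P] := Ut x0.
pose U' i := if i == i0 then U i else U i `&` [set x | t / 2 <= mdist x0 x].
have U'U i : U' i `<=` U i by rewrite /U'; case: ifP => _ x //; case.
exists U'; apply/not_existsP => /= noM.
apply: Ubad; have : exists c, coloring [set x | N%:R <= mdist x0 x] U' s c.
  apply: (@coloring_compact x0) => j; have /not_andP[|/contrapT[c cP]] := noM j.
    move=> Unthick; exfalso; apply: Unthick => x.
    have [xt|tx] := ltP (mdist x0 x) (3 * t / 4).
      exists i0 => y xy; rewrite /U' eqxx; apply: i0P.
      by have := metric_triangle x0 x y; rewrite /t in xt *; lra.
    have [i iP] := Ut x; exists i => y xy; rewrite /U'.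
    have Uiy : U i y by apply: iP; rewrite /t; lra.
    case: ifP => // _; split=> //=.
    have := metric_triangle x0 y x; rewrite (metric_sym y x) /t in tx *; lra.
  exists c; suff -> : [set x | N%:R <= mdist x0 x] `&`
      [set x | mdist x0 x < j%:R] = slab x0 N j by [].
  by apply/seteqP; split=> x /=; [case=> ? ?; apply/andP|case/andP].
move=> [c [cU cmiss]].
have cnear x : N%:R <= mdist x0 x -> mdist x0 x < t / 2 -> c x = i0.
  move=> Nx xt; have := cU x x Nx Nx; rewrite mdistxx => /(_ s0).
  by rewrite /U'; case: eqP => // _ [_ /=]; rewrite leNgt xt.
(* The switch occurs at [N + s], so the [s]-ball of a point colored by [c] stays in the region where
   [c] is a coloring. *)
exists (fun x => if mdist x0 x < N%:R + s then i0 else c x); split=> [x y _ _|y _].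
  have := metric_triangle x0 x y; have := metric_triangle x0 y x.
  rewrite (metric_sym y x) => ? ?.
  case: ifPn => [xN|]; first by move=> xy; apply: i0P; rewrite /t; lra.
  by rewrite -leNgt => xN xy; apply: U'U; apply: cU => //=; lra.
(* Within [s] of a point [y] of the first kind every color is [i0], so any other color is missed. *)
have [yN|Ny] := ltP (mdist x0 y) (N%:R + 2 * s).
  have [i ii0] : exists i : 'I_m.+2, i != i0.
    by exists (lift i0 ord0); rewrite eq_sym neq_lift.
  exists i => x _ xy; have := metric_triangle x0 y x.
  rewrite (metric_sym y x) => ?; case: ifPn => [_|].
    by move/esym/eqP; apply/negP.
  rewrite -leNgt => Nx; have -> : c x = i0 by apply: cnear; rewrite ?/t; lra.
  by move/esym/eqP; apply/negP.
have [|i iP] := cmiss y; first by rewrite /=; lra.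
exists i => x _ xy; have := metric_triangle x0 x y => ?.
case: ifPn => [xN|_].
  by exfalso; lra.
by apply: iP => //=; lra.
Qed.

End colorings.

(** * From large scale extension to colorings *)

(* If arbitrarily thick covers had no coloring, uncolorable bounded slabs
   could be found further and further out; the canonical maps of these covers
   into the simplex, restricted to where they land in the boundary, form one
   slowly oscillating map, and an extension of it yields a coloring. *)
Lemma ls_extensor_colorable (R : realType) (X : metricType R) (m : nat) :
  ls_absolute_extensor (sphere R m) X ->
  forall s : R, 0 < s -> exists2 t : R, 0 < t &
    forall U : 'I_m.+2 -> set X, thick U t -> exists c, coloring setT U s c.
Proof.
move=> ext s s0; have [[x0 _]|noX] := pselect (exists x : X, True); last first.
  exists 1 => // U _; exists (fun=> ord0).
  by split=> x; exfalso; apply: noX; exists x.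
apply: contrapT => noT.
have bad t : 0 < t -> exists2 U : 'I_m.+2 -> set X,
    thick U t & ~ exists c, coloring setT U s c.
  move=> t0; apply: contrapT => noU; apply: noT; exists t => // U Ut.
  by apply: contrapT => noc; apply: noU; exists U.
have /choice[F FP] : forall p : nat * nat, exists q : ('I_m.+2 -> set X) * nat,
    thick q.1 p.2.+1%:R /\ ~ exists c, coloring (slab x0 p.1 q.2) q.1 s c.
  move=> [N k]; have [U [M UM]] := uncolorable_slab x0 s0 bad N k.
  by exists (U, M).
(* Slab [k + 1] starts more than [k] beyond the end of slab [k]; the summand [N k'] makes [N]
   visibly monotone. *)
pose N := fix N k :=
  if k is k'.+1 then ((F (N k', k')).2 + k' + N k').+1 else 0%N.
pose U k := (F (N k, k)).1; pose M k := (F (N k, k)).2.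
have Uthick k : thick (U k) k.+1%:R := (FP (N k, k)).1.
have Ubad k : ~ exists c, coloring (slab x0 (N k) (M k)) (U k) s c :=
  (FP (N k, k)).2.
have NS k : N k.+1 = (M k + k + N k).+1 by [].
have Nmono j k : (j <= k)%N -> (N j <= N k)%N.
  move=> /subnK <-; elim: (k - j)%N => // i IH.
  by rewrite addSn NS (leq_trans IH)// leqW// leq_addl.
have Nk k : (k <= N k)%N by elim: k => // k IH; rewrite NS ltnS; lia.
have MN j k : (j < k)%N -> (M j + j <= N k)%N.
  by move=> /Nmono; apply: leq_trans; rewrite NS; lia.
have far j k x y : slab x0 (N j) (M j) x -> slab x0 (N k) (M k) y ->
    (j < k)%N -> j%:R < mdist x y.
  move=> /andP[_ xM] /andP[Ny _] /MN; rewrite -(ler_nat R) natrD => ?.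
  by have := metric_triangle x0 x y; lra.
have same j k x y : slab x0 (N j) (M j) x -> slab x0 (N k) (M k) y ->
    mdist x y <= j%:R -> mdist x y <= k%:R -> j = k.
  move=> xj yk xyj xyk; case: (ltngtP j k) => // [jk|kj].
    by have := far _ _ _ _ xj yk jk; rewrite ltNge xyj.
  by have := far _ _ _ _ yk xj kj; rewrite metric_sym ltNge xyk.
have uniq j k x : slab x0 (N j) (M j) x -> slab x0 (N k) (M k) x -> j = k.
  by move=> xj xk; apply: same xj xk _ _; rewrite mdistxx.
pose w k i x := 1 - proximity (~` U k i) k.+1%:R x.
have k0 k : 0 < k.+1%:R :> R by rewrite ltr0n.
have w0 k i x : 0 <= w k i x by rewrite subr_ge0 proximity_le1.
have wU k i x : ~ U k i x -> w k i x = 0.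
  by move=> nU; rewrite /w proximity1 ?subrr.
have wsum k x : 1 <= \sum_i w k i x.
  have [i iP] := Uthick k x; rewrite (bigD1 i)//= {1}/w proximity_eq0//.
    by rewrite subr0 lerDl sumr_ge0.
  by move=> y nUy; rewrite leNgt; apply/negP => /iP.
have wlip k i x y : `|w k i x - w k i y| <= k.+1%:R^-1 * mdist x y.
  have -> : w k i x - w k i y =
      proximity (~` U k i) k.+1%:R y - proximity (~` U k i) k.+1%:R x.
    by rewrite /w; ring.
  by rewrite distrC; exact: proximity_dist.
pose A := [set x | exists k, slab x0 (N k) (M k) x /\ exists i, ~ U k i x].
have /choice[f fP] : forall a : A, exists p : sphere R m, forall k,
    slab x0 (N k) (M k) (val a) ->
    forall i, sval p 0 i = w k i (val a) / \sum_j w k j (val a).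
  move=> a; have [k [ak [i nUi]]] : A (val a) by exact: set_valP.
  have [||p pE] := sphere_of_weights (w0 k ^~ (val a)).
  - exact: lt_le_trans ltr01 (wsum _ _).
  - by exists i; exact: wU.
  by exists p => l al; rewrite -(uniq _ _ _ ak al).
have fso : slowly_oscillating f.
  apply/(slowly_oscillatingP f x0 (fun a b => subset_mdistE a b)).
  move=> r eps r0 eps0.
  have [J1 rJ1] := natr_bound r.
  have [J2 rJ2] := natr_bound (2 * m.+2%:R * r / eps).
  pose J := maxn J1 J2.
  have rJ k : (J <= k)%N -> r < k%:R.
    by rewrite geq_max => /andP[Jk _]; apply: lt_le_trans rJ1 _; rewrite ler_nat.
  have eJ k : (J <= k)%N -> 2 * m.+2%:R * (k.+1%:R^-1 * r) < eps.
    rewrite geq_max => /andP[_ Jk]; rewrite mulrCA ltr_pdivrMl//.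
    rewrite -ltr_pdivrMr//; apply: lt_le_trans rJ2 _.
    by rewrite ler_nat leqW.
  exists ((N J)%:R + r) => a b Na; rewrite subset_mdistE => ab.
  have Nb : (N J)%:R < mdist x0 (val b).
    have := metric_triangle x0 (val b) (val a).
    by rewrite (metric_sym (val b)); lra.
  have Jle x k : slab x0 (N k) (M k) x -> (N J)%:R < mdist x0 x -> (J <= k)%N.
    move=> /andP[_ xM] Nx; rewrite leqNgt; apply/negP => /MN.
    move=> /(leq_trans (leq_addr _ _)); rewrite -(ler_nat R); lra.
  have [k [ak _]] : A (val a) by exact: set_valP.
  have [l [bl _]] : A (val b) by exact: set_valP.
  have Jk : (J <= k)%N by apply: Jle ak _; lra.
  have Jl := Jle _ _ bl Nb.
  have kl : k = l.
    by apply: same ak bl _ _; apply/ltW; apply: lt_trans ab _; exact: rJ.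
  rewrite -{l}kl in bl Jl.
  have : mdist (f a) (f b) <= 2 * m.+2%:R * (k.+1%:R^-1 * r) / 1.
    apply: (sphere_mdist_weights (fP a k ak) (fP b k bl)) => // [|i].
      exact: lt_le_trans ltr01 (wsum _ _).
    by apply: le_trans (wlip _ _ _ _) _; rewrite ler_pM2l ?invr_gt0// ltW.
  by rewrite divr1 => /le_lt_trans; apply; exact: eJ.
have [g gso gf] := ext A f fso.
have nV0 : 0 < m.+2%:R^-1 :> R by rewrite invr_gt0 ltr0n.
have [L LP] :=
  (slowly_oscillatingP (h := id) g x0 (fun _ _ => erefl)).1 gso _ _ s0 nV0.
have [k Lk] := natr_bound L.
have /choice[c cP] : forall x, exists i, m.+2%:R^-1 <= sval (g x) 0 i.
  by move=> x; exact: sphere_coord_large.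
apply: (Ubad k); exists c.
(* Slab [k] lies beyond [L], where [g] moves by less than 1/(m+2) over distance [s], so the large
   coordinate at [x] stays positive at [y]. *)
have gpos x y : slab x0 (N k) (M k) x -> mdist x y < s ->
    0 < sval (g y) 0 (c x).
  move=> /andP[Nx _] xy; have gxy : mdist (g x) (g y) < m.+2%:R^-1.
    apply: LP xy => /=; apply: lt_le_trans Lk _; apply: le_trans Nx.
    by rewrite ler_nat.
  have := le_lt_trans (le_trans (ler_norm _) (sphere_coord_le _ _ (c x))) gxy.
  by rewrite ltrBlDr => /(le_lt_trans (cP x)); rewrite ltrDl.
(* A point [y] outside [U k (c x)] would lie in [A], where [g] equals [f] and coordinate [c x]
   vanishes. For the second condition, a zero coordinate of [g y] is a missed color. *)
split=> [x y xk yk xy|y yk].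
  apply: contrapT => nU.
  have Ay : A y by exists k; split=> //; exists (c x).
  have := gpos x y xk xy; rewrite -[y]/(val (SigSub (mem_set Ay) : A)) gf.
  by rewrite (fP _ k)//= wU// mul0r ltxx.
have [i gi] := sphere_zero (g y); exists i => x xk xy cx.
by have := gpos x y xk xy; rewrite cx gi ltxx.
Qed.

(** * From colorings to uniform extension *)

Lemma min_max_le (R : realType) (a b c d D : R) :
  0 <= D -> a <= b + D -> c <= d + D ->
  Num.min (Num.max 0 a) c <= Num.min (Num.max 0 b) d + D.
Proof.
move=> D0 ab cd; rewrite -lerBlDr le_min !lerBlDr; apply/andP; split.
  have b_le : b <= Num.max 0 b by rewrite le_max lexx orbT.
  have ge0 : 0 <= Num.max 0 b by rewrite le_max lexx.
  by rewrite ge_min ge_max; apply/orP; left; apply/andP; split; lra.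
by rewrite ge_min cd orbT.
Qed.

(* Off [A] the extension is proportional to [w i = min (M i - k)^+ (phi i + nu)].
   Here [M i] is a McShane extension of the [i]-th coordinate of [f], [phi i] is
   supported near the [i]-th color class, hence where [M i] is large, and [nu]
   near [A]. Near [A] some [M i] is at most [k], and elsewhere some [phi i + nu]
   vanishes, so [w] always has a zero coordinate. *)
Lemma colorable_uniform_extensor (R : realType) (X : metricType R) (m : nat) :
  (forall s : R, 0 < s -> exists2 t : R, 0 < t &
    forall U : 'I_m.+2 -> set X, thick U t -> exists c, coloring setT U s c) ->
  uniform_extensor (sphere R m) X.
Proof.
move=> col r eps r0 eps0.
pose n : R := m.+2%:R; have n0 : 0 < n by rewrite ltr0n.
pose v : R := n^-1; have v0 : 0 < v by rewrite invr_gt0.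
have nv : n * v = 1 by rewrite divff// gt_eqF.
have v1 : v <= 1 by rewrite invf_le1// ler1n.
(* [k] serves both as oscillation bound for [f] and as truncation level: [k <= v / 8] keeps the sum
   of the weights above [v / 8], and [n k <= eps / 32] keeps [h] within [eps / 8] of [f] on [A]. *)
pose k : R := v / 8 * Num.min 1 (eps / 4).
have min0 : 0 < Num.min 1 (eps / 4) by rewrite lt_min ltr01/=; lra.
have v80 : 0 < v / 8 by lra.
have k0 : 0 < k by rewrite mulr_gt0.
have kv : k <= v / 8 by rewrite ger_pMr// ge_min lexx.
have nk : n * k <= eps / 32.
  have -> : n * k = Num.min 1 (eps / 4) / 8.
    by rewrite /k mulrA mulrA nv mul1r mulrC.
  have : Num.min 1 (eps / 4) <= eps / 4 by rewrite ge_min lexx orbT.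
  by lra.
(* Chosen so that the Lipschitz estimate for [h] at scale [r] comes out as exactly [eps / 4]. *)
pose s : R := 192 * r * n ^+ 2 / eps.
have s0 : 0 < s by rewrite divr_gt0// mulr_gt0 ?exprn_gt0// mulr_gt0.
have [t t0 tcol] := col s s0.
(* The two summands yield [s / T <= k] and [t / T <= v / 4]. *)
pose T : R := s / k + 4 * t / v.
have sk0 : 0 < s / k by rewrite divr_gt0.
have tv0 : 0 < 4 * t / v by rewrite divr_gt0// mulr_gt0.
have T0 : 0 < T by rewrite addr_gt0.
have TV0 : 0 < T^-1 by rewrite invr_gt0.
have TVge0 := ltW TV0.
have sT : T^-1 * s <= k.
  rewrite mulrC ler_pdivrMr// /T mulrDr mulrCA divff ?gt_eqF// mulr1 lerDl.
  by rewrite mulr_ge0// ltW.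
have tT : T^-1 * t <= v / 4.
  rewrite mulrC ler_pdivrMr// /T mulrDr.
  have -> : v / 4 * (4 * t / v) = t.
    have := gt_eqF v0 => /negbT ?; by field.
  by rewrite lerDr mulr_ge0//; apply: ltW => //; lra.
have TVs : T^-1 <= s^-1.
  rewrite -(ler_pM2r s0) mulVf ?gt_eqF//; apply: le_trans sT _; lra.
exists T, k; split=> // A f fosc.
pose F i x := sval (f x) 0 i.
have F0 i a : A a -> 0 <= F i a by move=> _; exact: sphere_ge0.
pose M i := mcshane A (F i) T^-1.
(* Otherwise every coordinate is small at some point of [A] within [T / 2] of [x]. These points are
   [T]-close, so their images are [k]-close, yet the first image has a coordinate at least [v]. *)
have Mlarge x : exists i, v / 2 <= M i x.
  apply/not_existsP => small.
  have /choice[a aP] : forall i, exists a,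
      A a /\ F i a + T^-1 * mdist x a < v / 2.
    move=> i; have : M i x < v / 2 by rewrite ltNge; apply/negP.
    by move=> /(mcshane_ltP (F0 i) TVge0)[]; [lra|move=> a Aa; exists a].
  have aT i : mdist x (a i) < T / 2.
    have [Aa Fa] := aP i.
    have : T^-1 * mdist x (a i) < 1 / 2 by have := F0 i _ Aa; lra.
    by rewrite mulrC ltr_pdivrMr// mulrAC mul1r mulrC.
  have [i vi] := sphere_coord_large (f (a ord0)).
  have [A0 _] := aP ord0; have [Ai Fi] := aP i.
  have : mdist (f (a ord0)) (f (a i)) < k.
    apply: fosc => //; have := metric_triangle (a ord0) x (a i).
    by rewrite (metric_sym (a ord0) x); have := aT ord0; have := aT i; lra.
  move=> /(le_lt_trans (le_trans (ler_norm _) (sphere_coord_le _ _ i))).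
  have : 0 <= T^-1 * mdist x (a i) by rewrite mulr_ge0// mdist_ge0.
  rewrite -/(F i (a i)); rewrite -/n -/v in vi; lra.
pose U i := [set x | v / 4 < M i x].
have Ut : thick U t.
  move=> x; have [i vM] := Mlarge x; exists i => y xy; rewrite /U/=.
  have := mcshane_lip (F0 i) TVge0 x y; rewrite -/(M i).
  have : T^-1 * mdist x y < T^-1 * t by rewrite ltr_pM2l.
  by lra.
have [c [cU cmiss]] := tcol U Ut.
pose phi i := proximity [set x | c x = i] s; pose nu := proximity A s.
pose w i x := Num.min (Num.max 0 (M i x - k)) (phi i x + nu x).
have w0 i x : 0 <= w i x.
  by rewrite le_min le_max lexx/= addr_ge0// proximity_ge0.
have wzero x : exists i, w i x = 0.
  have [nu0|nu_neq0] := eqVneq (nu x) 0.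
    have [i iP] := cmiss x I; exists i.
    rewrite /w nu0 /phi proximity_eq0// => [|a ca].
      by rewrite addr0; apply/min_idPr; rewrite le_max lexx.
    rewrite leNgt; apply/negP; rewrite metric_sym => ax.
    exact: iP ax ca.
  have [|a Aa xa] := @proximity_gt0P _ _ A s s0 x.
    by rewrite lt0r nu_neq0 proximity_ge0.
  have [i fi0] := sphere_zero (f a); exists i.
  have Mk : M i x - k <= 0.
    have := mcshane_upper (F0 i) TVge0 x Aa.
    have -> : F i a = 0 by exact: fi0.
    rewrite -/(M i).
    have : T^-1 * mdist x a < T^-1 * s by rewrite ltr_pM2l.
    by lra.
  rewrite /w (max_idPl Mk); apply/min_idPl.
  by rewrite addr_ge0// proximity_ge0.
(* The coordinate [c x] suffices: there [phi] is 1 and [M] exceeds [v / 4]. *)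
have wsum x : v / 8 <= \sum_i w i x.
  rewrite (bigD1 (c x))//=; apply: (@le_trans _ _ (w (c x) x)).
    rewrite /w /phi proximity1// le_min le_max.
    have Mx : v / 4 < M (c x) x by apply: cU; rewrite ?mdistxx.
    have := @proximity_ge0 _ _ A s s0 x; rewrite -/(nu x) => ?.
    by apply/andP; split; [apply/orP; right|]; lra.
  by rewrite lerDl sumr_ge0.
have wlip i x y : w i x <= w i y + 3 * (s^-1 * mdist x y).
  have D0 : 0 <= s^-1 * mdist x y by rewrite mulr_ge0 ?mdist_ge0// invr_ge0 ltW.
  apply: min_max_le.
  - by lra.
  - have := mcshane_lip (F0 i) TVge0 x y; rewrite -/(M i).
    have : T^-1 * mdist x y <= s^-1 * mdist x y by rewrite ler_wpM2r// mdist_ge0.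
    by lra.
  - have := proximity_lip [set x | c x = i] s0 x y.
    by have := proximity_lip A s0 x y; rewrite -/nu -/(phi i); lra.
have /choice[h hP] : forall x, exists p : sphere R m,
    forall i, sval p 0 i = w i x / \sum_j w j x.
  move=> x; apply: sphere_of_weights => //.
  by apply: lt_le_trans (wsum x); lra.
have wsum0 x : 0 < \sum_i w i x by apply: lt_le_trans (wsum x); lra.
have hosc x y : mdist x y < r -> mdist (h x) (h y) <= eps / 4.
  move=> xy; apply: (@le_trans _ _ (2 * n * (3 * (s^-1 * r)) / (v / 8))).
    apply: (sphere_mdist_weights (hP x) (hP y)) => // i.
    have sr : s^-1 * mdist x y <= s^-1 * r by rewrite ler_pM2l ?invr_gt0// ltW.
    have := wlip i x y; have := wlip i y x; rewrite (metric_sym y x) ler_norml.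
    by move=> ? ?; apply/andP; split; lra.
  rewrite le_eqVlt; apply/orP; left; apply/eqP; rewrite /s /v.
  have := lt0r_neq0 n0; have := lt0r_neq0 r0; have := lt0r_neq0 eps0 => ? ? ?.
  by field; do ?[apply/andP; split].
(* On [A] the weights differ from the coordinates of [f] by at most [2 k]: one [k] from the
   oscillation of [f], one from the truncation. *)
have hf a : A a -> mdist (f a) (h a) <= eps / 8.
  move=> Aa; apply: (@le_trans _ _ (2 * n * (2 * k) / 1)); last by lra.
  apply: (@sphere_mdist_weights _ _ _ _ (F ^~ a) _ _ _ _ (hP a)) => //.
  - by move=> i; rewrite sphere_sum divr1.
  - by rewrite sphere_sum.
  move=> i.
  have Mle1 : M i a <= 1 by exact: mcshane_le1 (F0 i) TVge0 _.
  have MF : M i a <= F i a.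
    by have := mcshane_upper (F0 i) TVge0 a Aa; rewrite mdistxx mulr0 addr0.
  have FM : F i a - k <= M i a.
    apply: mcshane_lower => [|b Ab].
      by have := sphere_le1 (f a) i; rewrite -/(F i a); lra.
    (* Points at distance at least [T] contribute at least 1 to the infimum, and a coordinate never
       exceeds 1. *)
    have [abT|Tab] := ltP (mdist a b) T.
      have := le_lt_trans (sphere_coord_le _ _ i) (fosc _ _ Aa Ab abT).
      have : 0 <= T^-1 * mdist a b by rewrite mulr_ge0// mdist_ge0.
      by rewrite ltr_norml -/(F i a) -/(F i b) => ? /andP[_]; lra.
    have : 1 <= T^-1 * mdist a b by rewrite mulrC ler_pdivlMr// mul1r.
    have := sphere_le1 (f a) i; rewrite -/(F i a).
    by have := F0 i _ Ab; lra.
  have := F0 i _ Aa => Fa0.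
  have -> : w i a = Num.max 0 (M i a - k).
    apply/min_idPl; rewrite /nu proximity1// ge_max.
    have := @proximity_ge0 _ _ [set x | c x = i] s s0 a; rewrite -/(phi i) => ?.
    by apply/andP; split; lra.
  by rewrite ler_norml; apply/andP; split; case: (leP 0 (M i a - k)) => ?; lra.
(* Restoring [f] on [A] costs [eps / 8] at each end, for a total of [eps / 2]. *)
exists (fun x => if `[< A x >] then f x else h x) => [x y _ _ xy|a Aa]; last first.
  by case: asboolP.
have gh z : mdist (if `[< A z >] then f z else h z) (h z) <= eps / 8.
  by case: asboolP => [/hf//|_]; rewrite mdistxx; lra.
apply: le_lt_trans (metric_triangle _ (h x) _) _.
have := metric_triangle (h x) (h y) (if `[< A y >] then f y else h y).
rewrite (metric_sym (h y)); have := gh x; have := gh y; have := hosc x y xy.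
by lra.
Qed.

(** * The equivalence *)

Lemma sphere_inhabited (R : realType) (m : nat) : exists p : sphere R m, True.
Proof.
have [i|||p] := @sphere_of_weights R m (fun i => (i == ord0)%:R).
- by rewrite ler0n.
- by rewrite (bigD1 ord0)//= big1 ?addr0 ?ltr01// => i /negbTE ->.
- by exists (lift ord0 ord0).
- by exists p.
Qed.

Theorem corollary5p2 (R : realType) (X : metricType R) (m : nat) :
  ls_absolute_extensor (sphere R m) X <->
  (forall s : R, 0 < s -> exists2 t : R, 0 < t &
     forall U : 'I_m.+2 -> set X,
       is_cover (range U) -> (t%:E < lebesgue_number (range U))%E ->
       exists V : set (set X),
         [/\ is_refinement (range U) V,
             (s%:E < lebesgue_number V)%E &
             cover_dim_le V m]).
Proof.
split=> [ext s s0|ref].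
  (* The extra 1 pays for the strict inequality demanded of the Lebesgue number. *)
  have [|t t0 tcol] := ls_extensor_colorable ext (s := s + 1); first by lra.
  exists t => // U _ /thick_lebesgue/tcol[c cP].
  by apply: coloring_refinement s0 _ cP; rewrite ltrDl.
have [p0 _] := sphere_inhabited R m.
have [[x0 _]|noX] := pselect (exists x : X, True); last first.
  move=> A f _; exists (fun=> p0) => x; first by exfalso; apply: noX; exists x.
  by exfalso; apply: noX; exists (val x).
apply: (uniform_extensor_ls p0 x0); apply: colorable_uniform_extensor => s s0.
have [t t0 tref] := ref s s0.
exists (t + 1) => [|U Ut]; first by lra.
have [||V [UV sV dimV]] := tref U.
- apply/seteqP; split=> // x _; have [i iP] := Ut x.
  by exists (U i); [exists i|apply: iP; rewrite mdistxx; lra].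
- by apply: lebesgue_thick Ut; [exact: ltW|rewrite ltrDl].
- exact: refinement_coloring UV sV dimV.
Qed.
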